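(* For every $r\in\mathbb Q_{>0}$ there exists a pseudo-symmetric smooth toric Fano variety $X$ such that $\delta(X)=r$.
   Context: All toric varieties are over an algebraically closed field. Gongyo indices. For a smooth projective toric variety $X$, a nonzero class $D\in\mathrm{Nef}(X)\cap\mathrm{Pic}(X)$ and $\mathbb K\in\{\mathbb Z,\mathbb Q\}$, put $$\tau_X(D;\mathbb K)=\sup\Big\{\sum_{i=1}^r a_i\ \Big|\ D=\sum_{i=1}^r a_iD_i,\ 0\ne D_i\in\mathrm{Nef}(X)\cap\mathrm{Pic}(X),\ a_i\in\mathbb K_{>0}\Big\}$$ (for $\mathbb K=\mathbb Q$ the equality is in $\mathrm{Pic}(X)\otimes\mathbb Q$). For a smooth toric Fano variety $X$, the Gongyo-index gap is $\delta(X):=\tau_X(-K_X;\mathbb Q)-\tau_X(-K_X;\mathbb Z)$. A smooth toric Fano variety $X=X_\Sigma$ of dimension $d$ is pseudo-symmetric if there is a maximal cone $\sigma\in\Sigma(d)$ with $-\sigma\in\Sigma(d)$. *)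

(* Defs.v *)
From HB Require Import structures.
From mathcomp Require Import all_boot all_order all_algebra.
From mathcomp Require Import classical_sets reals ereal.

Set Implicit Arguments.
Unset Strict Implicit.
Unset Printing Implicit Defensive.

Import Order.TTheory GRing.Theory Num.Theory.

Local Open Scope ring_scope.

(* The toric variety X_Sigma is given by its fan Sigma in N = Z^d.  The data
   used below (torus-invariant divisors, linear equivalence, intersection
   numbers with torus-invariant curves) depend only on Sigma, whatever the
   algebraically closed base field.

   A cone is recorded by the set S of its rays: [gen i] is the primitive
   generator of the ray i and the cone itself is [cone X S]. *)
Record fan (d : nat) := Fan {
  ray : finType;
  gen : ray -> 'rV[int]_d;
  cones : {set {set ray}}
}.

(* <m, u>, for m in M_K = Hom(N, Z) (x) K and u in N. *)
Definition pairing (K : numDomainType) (d : nat) (m : 'rV[K]_d)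
  (u : 'rV[int]_d) : K := \sum_(k < d) m 0 k * (u 0 k)%:~R.

Section Fan.
Variables (d : nat) (X : fan d).
Implicit Types S T : {set ray X}.

Definition genQ (i : ray X) : 'rV[rat]_d := map_mx intr (gen i).

(* All cones are rational polyhedral, so they are taken in N_Q. *)
Definition cone S : set 'rV[rat]_d :=
  [set x | exists c : ray X -> rat,
     (forall i, 0 <= c i) /\ x = \sum_(i in S) c i *: genQ i]%classic.

Definition cone_dim S : nat := \dim <<[seq genQ i | i in S]>>%VS.

(* The face of [cone S] cut out by a supporting hyperplane m = 0. *)
Definition is_face T S : Prop :=
  exists m : 'rV[int]_d,
    (forall i, i \in S -> 0 <= pairing m (gen i)) /\
    T = [set i in S | pairing m (gen i) == 0]%SET.

Definition primitive (u : 'rV[int]_d) : Prop :=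
  forall (n : nat) (v : 'rV[int]_d), u = v *+ n -> n = 1%N.

(* [is_face finset.set0 S] says that [cone S] is strongly convex, and
   [is_face [set i] S] that i is indeed one of its rays. *)
Definition is_fan : Prop :=
  [/\ forall i : ray X, primitive (gen i) /\ [set i]%SET \in cones X,
      finset.set0 \in cones X,
      forall S, S \in cones X ->
        is_face finset.set0 S /\ forall i, i \in S -> is_face [set i]%SET S,
      forall S T, S \in cones X -> is_face T S -> T \in cones X
    & forall S T, S \in cones X -> T \in cones X ->
        is_face (S :&: T)%SET S /\
        (cone S `&` cone T = cone (S :&: T)%SET)%classic].

Definition smooth_fan : Prop :=
  forall S, S \in cones X ->
    exists B : 'M[int]_d, B \in unitmx /\
      exists2 f : ray X -> 'I_d,
        {in S &, injective f} & {in S, forall i, row (f i) B = gen i}.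

Definition complete_fan : Prop :=
  forall x : 'rV[rat]_d, exists2 S, S \in cones X & cone S x.

Definition max_cones : {set {set ray X}} :=
  [set S in cones X | cone_dim S == d]%SET.

(* Torus-invariant divisors sum_rho D(rho) D_rho. *)
Definition divisor : Type := {ffun ray X -> int}.

(* Equality in Pic(X) (x) K = K^Sigma(1) / M_K; on a smooth X every Weil divisor
   is Cartier, and every divisor is linearly equivalent to an invariant one. *)
Definition lin_equiv (K : numDomainType) (D E : ray X -> K) : Prop :=
  exists m : 'rV[K]_d, forall i, D i - E i = pairing m (gen i).

Definition anticanonical : divisor := [ffun=> 1].

(* The maximal cones tau + i and tau + j meet along the wall tau; V(tau) is the
   corresponding torus-invariant curve. *)
Definition is_wall (tau : {set ray X}) (i j : ray X) : Prop :=
  [/\ i \notin tau, j \notin tau, i != j,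
      (i |: tau)%SET \in max_cones & (j |: tau)%SET \in max_cones].

Definition wall_relation (tau : {set ray X}) (i j : ray X) (b : ray X -> int) :
  Prop := gen i + gen j + \sum_(k in tau) gen k *~ b k = 0.

(* D . V(tau) on a smooth X: D_i . V(tau) = D_j . V(tau) = 1,
   D_k . V(tau) = b_k for k in tau, and D_k . V(tau) = 0 for the other k.
   The wall relation exists and determines b on tau. *)
Definition curve_degree (D : divisor) (tau : {set ray X}) (i j : ray X)
  (b : ray X -> int) : int := D i + D j + \sum_(k in tau) D k * b k.

(* On a complete toric variety the Mori cone is generated by the finitely many
   torus-invariant curves, so D is nef (ample) iff D . C >= 0 (> 0) for each
   of these; [ample] also forces X to be projective. *)
Definition nef (D : divisor) : Prop :=
  forall tau i j b, is_wall tau i j -> wall_relation tau i j b ->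
    0 <= curve_degree D tau i j b.

Definition ample (D : divisor) : Prop :=
  forall tau i j b, is_wall tau i j -> wall_relation tau i j b ->
    0 < curve_degree D tau i j b.

Definition smooth_toric_Fano : Prop :=
  [/\ is_fan, smooth_fan, complete_fan & ample anticanonical].

Definition pseudo_symmetric : Prop :=
  exists S T, [/\ S \in max_cones, T \in max_cones &
    cone T = [set - x | x in cone S]%classic].

(* Sums of the a_l over the decompositions D = sum_l a_l E_l in Pic(X) (x) K. *)
Definition decomposition_weights (K : numDomainType) (D : divisor) : set K :=
  [set w | exists (n : nat) (a : 'I_n -> K) (E : 'I_n -> divisor),
     [/\ forall l, 0 < a l,
         forall l, nef (E l) /\ ~ lin_equiv (E l) (fun=> 0),
         lin_equiv (fun i => (D i)%:~R)
                   (fun i => \sum_(l < n) a l * (E l i)%:~R)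
       & w = \sum_(l < n) a l]]%classic.

Variable R : realType.

Definition tauZ (D : divisor) : \bar R :=
  ereal_sup [set (w%:~R)%:E | w in @decomposition_weights int D]%classic.

Definition tauQ (D : divisor) : \bar R :=
  ereal_sup [set (ratr w)%:E | w in @decomposition_weights rat D]%classic.

Definition Gongyo_gap : \bar R := (tauQ anticanonical - tauZ anticanonical)%E.

End Fan.

(* Main.v *)
Require Import Defs.
From mathcomp Require Import all_boot all_order all_algebra.
From mathcomp Require Import zify ring lra.
From mathcomp Require Import classical_sets reals ereal.
From mathcomp Require Import fintype finset.

Set Implicit Arguments.
Unset Strict Implicit.
Unset Printing Implicit Defensive.

Import Order.TTheory GRing.Theory Num.Theory.
Local Open Scope ring_scope.

(** The variety is the N-th power of the del Pezzo variety V of dimension 2k,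
    k >= 2.  The rays of V are the 2(2k+1) vectors +v_i and -v_i, where
    v_0, ..., v_2k span Z^2k and add up to 0; a set of them spans a cone when
    it uses at most k positive and at most k negative rays, with distinct
    indices.  Opposite facets exist by the symmetry v -> -v.

    The primitive relations of degree one are, for a set B of k indices and a
    sign e, that the sum of e v_i over i outside B is the sum of -e v_i over i
    in B.  Hence D is nef exactly when D(e v_i) summed outside B dominates
    D(-e v_i) summed over B ([primitive_nef_nef], [nef_primitive_nef]).  Put
    c_i = D(v_i) + D(-v_i) >= 0.  Adding the inequalities for the two signs,
    the sum of c over any k indices is at most the sum over the other k+1.
    If fewer than k of the c_i were nonzero, this would force c = 0; so, for an
    integral D, either D is trivial or at least k of the c_i are >= 1, and then
    the degree W(D), the sum of all the c_i, is at least 2k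
    ([primitive_nef_deg_ge]).  The degree is invariant under linear
    equivalence, and W(-K) = 4k+2.

    Therefore the weights in a decomposition of -K on V add up to at most
    (4k+2)/2k = 2 + 1/k, and to at most 2 if they are integers, because
    4k+2 < 6k.  Both bounds are attained: -K is 1/k times the sum of the 2k+1
    nef classes of degree 2k ([corner_divisor]), and it is the sum of two nef
    divisors of degree 2k+1 ([half_divisor]).  On the N-th power the same
    argument is run factor by factor ([weights_le]), so that the gap is N/k
    ([dP_gap]).  For r = p/q take N = 2p and k = 2q, which is at least 2.

    The fan axioms, completeness and the Fano property come from explicit
    support functions: each cone has a rational linear form equal to 1 on its
    rays and less than 1 on all the others ([dp_strictly_supports]). *)

(** * Preliminaries on sums and on the pairing *)

Lemma sum_indicator (K : pzSemiRingType) (I : finType) (A : {set I}) (j : I) :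
  \sum_(i in A) (i == j)%:R = (j \in A)%:R :> K.
Proof.
have [jA|jA] := boolP (j \in A).
  rewrite (bigD1 j)//= eqxx big1 ?addr0// => i /andP[_ /negbTE->//].
by rewrite big1// => i iA; case: eqP jA => // <-; rewrite iA.
Qed.

Lemma sum_mul_pred1 (K : pzSemiRingType) (I : finType) (f : I -> K) (j : I) :
  \sum_i f i * (i == j)%:R = f j.
Proof.
by rewrite (bigD1 j)//= eqxx mulr1 big1 ?addr0// => i /negbTE->; rewrite mulr0.
Qed.

Lemma sum_pred1 (K : pzSemiRingType) (I : finType) (j : I) :
  \sum_i (i == j)%:R = 1 :> K.
Proof. by under eq_bigr do rewrite -[_%:R]mul1r; exact: sum_mul_pred1. Qed.

Section Pairing.
Variables (K : numDomainType) (d : nat).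
Implicit Types (m : 'rV[K]_d) (u v : 'rV[int]_d).

Lemma pairingE m u : pairing m u = (m *m (map_mx intr u)^T) 0 0.
Proof. by rewrite /pairing mxE; apply: eq_bigr => k _; rewrite !mxE. Qed.

Lemma pairing0l u : pairing (0 : 'rV[K]_d) u = 0.
Proof. by rewrite pairingE mul0mx mxE. Qed.

Lemma pairingDr m u v : pairing m (u + v) = pairing m u + pairing m v.
Proof. by rewrite !pairingE map_mxD linearD mulmxDr mxE. Qed.

Lemma pairing0r m : pairing m 0 = 0.
Proof. by rewrite pairingE map_mx0 trmx0 mulmx0 mxE. Qed.

Lemma pairingMzr m u z : pairing m (u *~ z) = pairing m u * z%:~R.
Proof.
rewrite /pairing mulr_suml; apply: eq_bigr => k _.
have -> : (u *~ z) 0 k = u 0 k * z.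
  by rewrite -scaler_int mxE mulrC intz.
by rewrite rmorphM/= mulrA.
Qed.

Lemma pairing_sumr m (I : Type) (s : seq I) (P : pred I) (F : I -> 'rV[int]_d) :
  pairing m (\sum_(i <- s | P i) F i) = \sum_(i <- s | P i) pairing m (F i).
Proof. exact: (big_morph _ (pairingDr m) (pairing0r m)). Qed.

Lemma pairing_suml (I : Type) (s : seq I) (P : pred I) (F : I -> 'rV[K]_d) u :
  pairing (\sum_(i <- s | P i) F i) u = \sum_(i <- s | P i) pairing (F i) u.
Proof.
by rewrite pairingE mulmx_suml summxE; apply: eq_bigr => i _; rewrite pairingE.
Qed.

End Pairing.

Lemma pairing_intr (K : numDomainType) (d : nat) (m u : 'rV[int]_d) :
  pairing (map_mx intr m : 'rV[K]_d) u = (pairing m u)%:~R.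
Proof.
rewrite /pairing rmorph_sum; apply: eq_bigr => k _.
by rewrite mxE rmorphM/= intz.
Qed.

Lemma mul_sum_scale (K : comPzRingType) (d : nat) (I : finType) (P : pred I)
    (m : 'rV[K]_d) (c : I -> K) (v : I -> 'rV[K]_d) :
  (m *m (\sum_(i | P i) c i *: v i)^T) 0 0
  = \sum_(i | P i) c i * (m *m (v i)^T) 0 0.
Proof.
rewrite linear_sum mulmx_sumr summxE; apply: eq_bigr => i _.
by rewrite linearZ /= -scalemxAr mxE.
Qed.

(** * Smooth fans and support functions *)

Section Fans.
Variables (d : nat) (X : fan d).
Implicit Types (S T : {set ray X}) (m : 'rV[rat]_d).

Lemma mul_genQ_sum m S (c : ray X -> rat) :
  (m *m (\sum_(i in S) c i *: genQ i)^T) 0 0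
  = \sum_(i in S) c i * pairing m (gen i).
Proof.
by rewrite mul_sum_scale; apply: eq_bigr => i _; rewrite pairingE.
Qed.

Definition supports (D : ray X -> rat) S m :=
  (forall i, i \in S -> pairing m (gen i) = D i)
  /\ (forall i, i \notin S -> pairing m (gen i) <= D i).

Definition strictly_supports (D : ray X -> rat) S m :=
  (forall i, i \in S -> pairing m (gen i) = D i)
  /\ (forall i, i \notin S -> pairing m (gen i) < D i).

(** If m agrees with D on one side of a wall, pairing the wall relation with m
    shows that the degree measures by how much D exceeds m at the ray on the
    other side.  This gives nefness and ampleness criteria that do not need
    the walls of the fan to be classified. *)
Lemma curve_degree_support (D : divisor X) (tau : {set ray X}) i j b m :
  wall_relation tau i j b ->
  (forall l, l \in i |: tau -> pairing m (gen l) = (D l)%:~R) ->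
  (curve_degree D tau i j b)%:~R = (D j)%:~R - pairing m (gen j).
Proof.
move=> rel mD.
have : pairing m (gen i + gen j + \sum_(k in tau) gen k *~ b k) = 0.
  by rewrite rel pairing0r.
rewrite !pairingDr pairing_sumr mD ?setU11//.
have -> : \sum_(l in tau) pairing m (gen l *~ b l) = (\sum_(k in tau) D k * b k)%:~R.
  rewrite rmorph_sum; apply: eq_bigr => l lt /=.
  by rewrite pairingMzr mD ?rmorphM// setU1r.
rewrite /curve_degree !rmorphD/= => e; lra.
Qed.

Lemma wall_notin (tau : {set ray X}) i j : is_wall tau i j -> j \notin i |: tau.
Proof. by case=> _ jt ij _ _; rewrite !inE negb_or jt eq_sym ij. Qed.

Lemma supports_nef (D : divisor X) :
  (forall S, S \in max_cones X -> exists m, supports (fun i => (D i)%:~R) S m) ->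
  nef D.
Proof.
move=> sup tau i j b w rel; have [_ _ _ Sm _] := w.
have [m [mS mN]] := sup _ Sm.
rewrite -(ler0z rat) (curve_degree_support rel mS) subr_ge0.
exact/mN/wall_notin.
Qed.

Lemma strictly_supports_ample (D : divisor X) :
  (forall S, S \in max_cones X ->
     exists m, strictly_supports (fun i => (D i)%:~R) S m) ->
  ample D.
Proof.
move=> sup tau i j b w rel; have [_ _ _ Sm _] := w.
have [m [mS mN]] := sup _ Sm.
rewrite -(ltr0z rat) (curve_degree_support rel mS) subr_gt0.
exact/mN/wall_notin.
Qed.

(** Evaluated at a point of cone S written with coefficients c, m returns the
    sum of c; evaluated on a second expression over T it loses weight on each
    ray of T outside S.  Used with S and T exchanged, this makes two
    expressions of a common point both live on S and T. *)
Lemma cone_capS S T m : strictly_supports (fun=> 1) S m ->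
  forall c c' : ray X -> rat, (forall i, 0 <= c' i) ->
  \sum_(i in S) c i *: genQ i = \sum_(i in T) c' i *: genQ i ->
  \sum_(i in S) c i <= \sum_(i in T) c' i ?= iff
    [forall i in T, (i \notin S) ==> (c' i == 0)].
Proof.
move=> [mS mN] c c' c'0 /(congr1 (fun x => (m *m x^T) 0 0)).
rewrite !mul_genQ_sum => e.
have -> : \sum_(i in S) c i = \sum_(i in T) c' i * pairing m (gen i).
  by rewrite -e; apply: eq_bigr => i iS; rewrite mS// mulr1.
apply: leif_sum => i iT.
have [iS|iS] := boolP (i \in S); first by rewrite mS// mulr1; split; rewrite ?eqxx.
have := mN _ iS; set t := pairing _ _ => t1.
split; first by rewrite ler_piMr// ltW.
by rewrite -{2}[c' i]mulr1 -subr_eq0 -mulrBr mulf_eq0 subr_eq0 (lt_eqF t1) orbF.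
Qed.

Lemma cone_setI S T mS mT :
  strictly_supports (fun=> 1) S mS -> strictly_supports (fun=> 1) T mT ->
  (cone S `&` cone T = cone (S :&: T)%SET)%classic.
Proof.
move=> sS sT; apply/seteqP; split=> x.
  move=> [[c [c0 xc]] [c' [c'0 xc']]].
  have e := esym xc; rewrite xc' in e.
  have l1 := cone_capS sS c'0 e.
  have l2 := cone_capS sT c0 (esym e).
  have := l1.2; rewrite eq_le l1.1 l2.1 /= => /esym/'forall_in_implyP z.
  exists c'; split=> //; rewrite xc'.
  rewrite [LHS](bigID (fun i => i \in S))/= [X in _ + X]big1 ?addr0.
    by apply: eq_bigl => i; rewrite !inE andbC.
  by move=> i /andP[iT /(z _ iT)/eqP->]; rewrite scale0r.
move=> [c [c0 ->]].
split.
  exists (fun i => if i \in T then c i else 0); split=> [i|]; first by case: ifP.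
  rewrite [RHS](bigID (fun i => i \in T))/= [X in _ = _ + X]big1 ?addr0.
    by apply: eq_big => [i|i]; rewrite !inE// => /andP[_ ->].
  by move=> i /andP[_ /negbTE->]; rewrite scale0r.
exists (fun i => if i \in S then c i else 0); split=> [i|]; first by case: ifP.
rewrite [RHS](bigID (fun i => i \in S))/= [X in _ = _ + X]big1 ?addr0.
  by apply: eq_big => [i|i]; rewrite !inE; [exact: andbC | case/andP=> ->].
by move=> i /andP[_ /negbTE->]; rewrite scale0r.
Qed.

Hypothesis X_smooth : smooth_fan X.

Lemma smooth_dual S i : S \in cones X -> i \in S ->
  exists m : 'rV[int]_d, forall j, j \in S -> pairing m (gen j) = (i == j)%:R.
Proof.
move=> Sc iS; have [B [Bu [f finj fB]]] := X_smooth Sc.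
exists (col (f i) (invmx B))^T => j jS.
rewrite -(fB _ jS).
have -> : pairing (col (f i) (invmx B))^T (row (f j) B)
   = (B *m invmx B) (f j) (f i).
  rewrite /pairing mxE; apply: eq_bigr => l _.
  by rewrite !mxE intz mulrC.
by rewrite mulmxV// mxE eq_sym (inj_in_eq finj).
Qed.

(** The sum of the dual basis vectors of the rays in S minus T vanishes on T and
    is 1 on the other rays of S. *)
Lemma smooth_face S T : S \in cones X -> T \subset S -> is_face T S.
Proof.
move=> Sc TS.
have /fin_all_exists[m mP] : forall i : ray X, exists m : 'rV[int]_d,
   i \in S -> forall j, j \in S -> pairing m (gen j) = (i == j)%:R.
  move=> i; have [iS|iS] := boolP (i \in S); last by exists 0.
  by have [m mP] := smooth_dual Sc iS; exists m.
have E j : j \in S -> pairing (\sum_(i in S :\: T) m i) (gen j) = (j \notin T)%:R.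
  move=> jS; rewrite pairing_suml.
  rewrite (eq_bigr (fun i => (i == j)%:R)); last first.
    by move=> i; rewrite inE => /andP[_ iS]; exact: mP.
  by rewrite sum_indicator inE jS andbT.
exists (\sum_(i in S :\: T) m i); split=> [j jS|].
  by rewrite E// ler0n.
apply/setP=> j; rewrite inE.
have [jS|jS] := boolP (j \in S); last by apply: contraNF jS => /(subsetP TS).
by rewrite E//; case: (j \in T).
Qed.

(** A dual vector takes the value 1 at the generator, so every integer dividing
    the generator divides 1. *)
Lemma smooth_primitive i : [set i]%SET \in cones X -> primitive (gen i).
Proof.
move=> ic n v gv; have [m /(_ i (set11 i))] := smooth_dual ic (set11 i).
rewrite eqxx gv pmulrn pairingMzr => /(congr1 absz).
rewrite abszM => /eqP; rewrite muln_eq1 => /andP[_ /eqP].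
by rewrite intz.
Qed.

(** Dual vectors read off the coefficients of a linear relation, so the
    generators of a smooth cone are linearly independent. *)
Lemma smooth_cone_dim S : S \in cones X -> cone_dim S = #|S|.
Proof.
move=> Sc.
suff /eqP : free [seq genQ i | i in S] by rewrite size_image.
apply: (introT (freeP (X := in_tuple _))) => c c0 l.
have lS : (l < size (enum S))%N.
  by have := ltn_ord l; rewrite [X in (_ < X)%N]size_map.
have i0 : ray X by case: (enum S) lS => // i.
have iS : nth i0 (enum S) l \in S by rewrite -mem_enum mem_nth.
have [m mP] := smooth_dual Sc iS.
move/(congr1 (fun x => (map_mx intr m *m x^T) 0 0)): c0.
rewrite mul_sum_scale trmx0 mulmx0 mxE (bigD1 l)//= big1 ?addr0 => [|j jl].
  rewrite (nth_map i0)// /genQ -pairingE pairing_intr mP// eqxx mulr1//.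
have jS : (j < size (enum S))%N.
  by have := ltn_ord j; rewrite [X in (_ < X)%N]size_map.
have jS' : nth i0 (enum S) j \in S by rewrite -mem_enum mem_nth.
rewrite (nth_map i0)// /genQ -pairingE pairing_intr mP//.
by rewrite nth_uniq ?enum_uniq// (inj_eq val_inj) eq_sym (negbTE jl) mulr0.
Qed.

Lemma smooth_max_conesP S : (S \in max_cones X) = (S \in cones X) && (#|S| == d).
Proof.
by rewrite inE; have [Sc|//] := boolP (S \in cones X); rewrite smooth_cone_dim.
Qed.

Lemma smooth_is_fan :
  (forall i : ray X, [set i]%SET \in cones X) ->
  (forall S T, S \in cones X -> T \subset S -> T \in cones X) ->
  set0 \in cones X ->
  (forall S, S \in cones X -> exists m, strictly_supports (fun=> 1) S m) ->
  is_fan X.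
Proof.
move=> X1 Xsub X0 Xsup; split=> //.
- by move=> i; split=> //; exact: smooth_primitive.
- move=> S Sc; split=> [|i iS]; apply: smooth_face; rewrite ?sub0set//.
  by rewrite sub1set.
- move=> S T Sc [m [_ ->]]; apply: Xsub Sc _.
  by apply/subsetP => i; rewrite inE => /andP[].
- move=> S T Sc Tc; split; first by apply: smooth_face => //; exact: subsetIl.
  have [mS sS] := Xsup _ Sc; have [mT sT] := Xsup _ Tc.
  exact: cone_setI sS sT.
Qed.

End Fans.

(** * Combinatorics of finite sets *)

Lemma subset_card_between (T : finType) (P Q : {set T}) (n : nat) :
  P \subset Q -> (#|P| <= n <= #|Q|)%N ->
  exists A : {set T}, [/\ P \subset A, A \subset Q & #|A| = n].
Proof.
move=> PQ /andP[Pn nQ].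
have [e ne] : exists e, (n = #|P| + e)%N by exists (n - #|P|)%N; rewrite subnKC.
elim: e n ne Pn nQ => [|e IH] n ne Pn nQ; first by exists P; rewrite ne addn0.
case: (IH (#|P| + e)%N) => //; [lia..|move=> A [PA AQ cA]].
have /subsetPn[x xQ xA] : ~~ (Q \subset A).
  by apply/negP => /subset_leq_card; lia.
exists (x |: A)%SET; rewrite subUset sub1set xQ AQ cardsU1 xA cA.
by split=> //; [exact: subset_trans PA (subsetUr _ _) | lia].
Qed.

(** Since v_0, ..., v_2k span the lattice and add up to 0, a linear form on it
    amounts to a function on the indices with sum 0.  The form that must take the values p at v_i for
    i in A, and q at -v_i for i in B, is completed to one of sum 0 by a common
    value on the remaining indices. *)
Section Balanced.
Variables (T : finType) (A B : {set T}) (p q : T -> rat).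

Definition balance_const : rat :=
  (\sum_(i in B) q i - \sum_(i in A) p i) / (#|T| - (#|A| + #|B|))%:R.

Definition balanced (i : T) : rat :=
  if i \in A then p i else if i \in B then - q i else balance_const.

Lemma sum_balanced : (#|A| + #|B| < #|T|)%N -> [disjoint A & B] ->
  \sum_i balanced i = 0.
Proof.
move=> cAB dAB.
rewrite (bigID (fun i => i \in A))/= (eq_bigr p); last by rewrite /balanced => i ->.
rewrite [X in _ + X](bigID (fun i => i \in B))/=.
rewrite [X in _ + (X + _)](eq_bigl (fun i => i \in B)); last first.
  move=> i /=; have [iB|_] := boolP (i \in B); last by rewrite andbF.
  by rewrite (disjointFl dAB iB).
rewrite [X in _ + (X + _)](eq_bigr (fun i => - q i)); last first.
  by move=> i iB; rewrite /balanced (disjointFl dAB iB) iB.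
rewrite [X in _ + (_ + X)](eq_bigr (fun=> balance_const)); last first.
  by move=> i /andP[/negbTE iA /negbTE iB]; rewrite /balanced iA iB.
rewrite [X in _ + (_ + X)](eq_bigl (fun i => i \in (~: (A :|: B))%SET)); last first.
  by move=> i; rewrite /= !inE negb_or.
rewrite sumr_const cardsCs setCK cardsU.
have -> : (A :&: B = set0)%SET by apply: disjoint_setI0.
rewrite cards0 subn0 sumrN -[balance_const *+ _]mulr_natr /balance_const.
rewrite divfK ?pnatr_eq0; first by ring.
by rewrite subn_eq0 -ltnNge.
Qed.

End Balanced.

(** A value y i is admissible if at most k entries exceed it; the smallest
    admissible one is a median.  If more than k entries were below it, the
    largest of these would again be admissible. *)
Lemma median_exists k (y : 'I_(k.*2.+1) -> rat) :
  exists t : rat, (#|[set i | (t < y i)%R]| <= k)%N /\ (#|[set i | (y i < t)%R]| <= k)%N.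
Proof.
pose P i := (#|[set j | (y i < y j)%R]| <= k)%N.
have P0 : P [arg max_(i > ord0) y i]%O.
  rewrite /P; case: arg_maxP => // i _ mi.
  rewrite (_ : [set j | _] = set0) ?cards0//.
  by apply/setP => j; rewrite !inE; apply/negbTE; rewrite -leNgt; exact: mi.
case: (arg_minP y P0) => i Pi mi.
exists (y i); split=> //; rewrite leqNgt; apply/negP => L.
have /card_gt0P[l0 l0L] : (0 < #|[set j | (y j < y i)%R]|)%N by lia.
move: l0L; rewrite inE => l0L.
case: (@arg_maxP _ _ _ l0 (fun l => y l < y i) y l0L) => l li ml.
have : P l.
  rewrite /P; have := cardsC [set j | y j < y i]; rewrite card_ord => e.
  suff : (#|[set j | (y l < y j)%R]| <= #|~: [set j | (y j < y i)%R]|)%N by lia.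
  apply: subset_leq_card; apply/subsetP => j; rewrite !inE => lj.
  by apply: contraL lj => ji; rewrite -leNgt; exact: ml.
by move=> /mi; rewrite leNgt li.
Qed.

(** * The fan of a power of a del Pezzo variety *)

Section DelPezzo.
Variables (N k : nat).
Local Notation I := 'I_(k.*2.+1).

(** Coordinates of the lattice: the 2k coordinates of each of the N factors, of
    which a row vector of size [dp_dim] lists the values. *)
Definition dp_coord := ('I_N * 'I_(k.*2))%type.
Definition dp_dim := #|{: dp_coord}|.
(** The ray (b, e, i) is v_i or -v_i in the factor b, according to e. *)
Definition dp_ray := ('I_N * bool * I)%type.
Definition sg (e : bool) : int := if e then 1 else -1.

(** The coordinates of v_i: the basis vectors e_j are v_(j+1), and v_0 is minus
    their sum. *)
Definition block_gen (i : I) (j : 'I_(k.*2)) : int :=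
  (i == lift ord0 j)%:R - (i == ord0)%:R.

Definition dp_gen (r : dp_ray) : 'rV[int]_dp_dim :=
  \row_l (if r.1.1 == (enum_val l).1
          then sg r.1.2 * block_gen r.2 (enum_val l).2 else 0).

Definition slice (S : {set dp_ray}) (p : 'I_N * bool) : {set I} :=
  [set i | (p, i) \in S].

Definition dp_cones : {set {set dp_ray}} :=
  [set S : {set dp_ray} | [forall p, (#|slice S p| <= k)%N] &&
     [forall b, [disjoint slice S (b, true) & slice S (b, false)]]].

Definition dP : fan dp_dim := Fan dp_gen dp_cones.

Lemma sum_rays (V : nmodType) (F : dp_ray -> V) :
  \sum_r F r = \sum_b \sum_e \sum_i F (b, e, i).
Proof.
by rewrite pair_bigA/= pair_bigA; apply: eq_bigr => -[[]].
Qed.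

Lemma dp_conesP (S : {set dp_ray}) :
  reflect ((forall p, #|slice S p| <= k)%N /\
     forall b, [disjoint slice S (b, true) & slice S (b, false)])
    (S \in dp_cones).
Proof.
rewrite inE; apply: (iffP andP) => -[h1 h2].
  by split; [apply/forallP|apply/forallP].
by split; [apply/forallP|apply/forallP].
Qed.

Section Pairing.
Variable K : numDomainType.

Lemma sum_coords (F : dp_coord -> K) :
  \sum_(l < dp_dim) F (enum_val l) = \sum_b \sum_j F (b, j).
Proof.
rewrite -(big_enum_val (A := {: dp_coord})) (eq_bigl xpredT)// pair_bigA.
by apply: eq_bigr => -[].
Qed.

Lemma pairing_dp_gen (m : 'rV[K]_dp_dim) b e i :
  pairing m (dp_gen (b, e, i)) = (sg e)%:~R *
    \sum_j m 0 (enum_rank (b, j)) * (block_gen i j)%:~R.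
Proof.
rewrite /pairing.
pose F (c : dp_coord) := m 0 (enum_rank c) *
  (if b == c.1 then sg e * block_gen i c.2 else 0)%:~R.
rewrite (eq_bigr (F \o enum_val)) => [|l _]; last by rewrite /F/= enum_valK mxE.
rewrite (sum_coords F) (bigD1 b)//= [X in _ + X]big1 ?addr0 => [|b' b'b].
  by rewrite mulr_sumr; apply: eq_bigr => j _; rewrite /F eqxx rmorphM/= mulrCA.
by rewrite big1// => j _; rewrite /F eq_sym (negbTE b'b) mulr0.
Qed.

Lemma sum_pairing_dp_gen (m : 'rV[K]_dp_dim) b e :
  \sum_i pairing m (dp_gen (b, e, i)) = 0.
Proof.
rewrite (eq_bigr _ (fun i _ => pairing_dp_gen m b e i)) -mulr_sumr.
rewrite exchange_big big1 ?mulr0//= => j _.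
rewrite -mulr_sumr -rmorph_sum sumrB.
by rewrite !sum_pred1 subrr mulr0.
Qed.

(** The linear form with value g b i at v_i in the factor b, when each g b has
    sum 0; the coordinates on the basis are the values at the i > 0. *)
Definition dual_row (g : 'I_N -> I -> K) : 'rV[K]_dp_dim :=
  \row_l g (enum_val l).1 (lift ord0 (enum_val l).2).

Lemma pairing_dual_row (g : 'I_N -> I -> K) b e i :
  \sum_i g b i = 0 -> pairing (dual_row g) (dp_gen (b, e, i)) = (sg e)%:~R * g b i.
Proof.
move=> g0; rewrite pairing_dp_gen; congr (_ * _).
rewrite (eq_bigr (fun j => g b (lift ord0 j) * (i == lift ord0 j)%:R
   - g b (lift ord0 j) * (i == ord0)%:R)); last first.
  by move=> j _; rewrite mxE enum_rankK rmorphB/= !rmorph_nat mulrBr.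
rewrite sumrB -mulr_suml; have := g0; rewrite big_ord_recl => /eqP.
rewrite addrC addr_eq0 => /eqP->.
case: (unliftP ord0 i) => [j ->|->].
  rewrite (bigD1 j)//= eqxx mulr1 big1 ?addr0 ?mulr0 ?subr0// => l lj.
  by rewrite (inj_eq lift_inj) eq_sym (negbTE lj) mulr0.
by rewrite eqxx mulr1 opprK big1 ?add0r// => j _; rewrite mulr0.
Qed.

End Pairing.

Lemma dp_gen_neg b e i : dp_gen (b, ~~ e, i) = - dp_gen (b, e, i).
Proof.
apply/rowP => l; rewrite !mxE/=; case: ifP => _; rewrite ?oppr0//.
by case: e; rewrite /sg /= !mulN1r ?mul1r ?opprK.
Qed.

Lemma sum_dp_gen b e : \sum_i dp_gen (b, e, i) = 0.
Proof.
apply/rowP => l; rewrite summxE mxE.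
have := sum_pairing_dp_gen (delta_mx 0 l : 'rV[int]_dp_dim) b e.
apply: etrans; apply: eq_bigr => i _; rewrite pairingE.
by rewrite -rowE !mxE intz.
Qed.

Lemma dp_card_slices (S : {set dp_ray}) : #|S| = (\sum_p #|slice S p|)%N.
Proof.
under [RHS]eq_bigr => p _ do rewrite -sum1dep_card big_mkcond.
by rewrite pair_bigA -sum1_card big_mkcond; apply: eq_bigr => -[].
Qed.

Lemma dp_dimE : dp_dim = (N * k.*2)%N.
Proof. by rewrite /dp_dim cardT -cardE card_prod !card_ord. Qed.

End DelPezzo.

(** * The Fano property *)

(** The common value of the support function on the indices that a cone with a
    positive and c negative rays leaves free. *)
Lemma ratio_lt1 (k a c : nat) : (a <= k)%N -> (c <= k)%N ->
  `|(c%:R - a%:R) / (k.*2.+1 - (a + c))%:R| < 1 :> rat.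
Proof.
move=> ak ck; have p0 : (0 < (k.*2.+1 - (a + c)))%N by lia.
rewrite normrM normfV (ger0_norm (ler0n _ _)) ltr_pdivrMr ?ltr0n// mul1r.
rewrite natrB; last by lia.
move: ak ck; rewrite -!(ler_nat rat) -addnn -addn1 !natrD => *.
by rewrite ltr_norml; apply/andP; split; lra.
Qed.

Section DelPezzoFano.
Variables (N k : nat).
Hypothesis k_gt0 : (0 < k)%N.
Local Notation I := 'I_(k.*2.+1).
Local Notation X := (dP N k).
Implicit Types (S T : {set dp_ray N k}) (b : 'I_N) (e : bool) (i : I).

Lemma slice_sub S T p : T \subset S -> slice T p \subset slice S p.
Proof. by move=> /subsetP TS; apply/subsetP => i; rewrite !inE => /TS. Qed.

Lemma dp_cones_sub S T : S \in dp_cones N k -> T \subset S -> T \in dp_cones N k.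
Proof.
move=> /dp_conesP[Sk Sd] TS; apply/dp_conesP; split=> [p|b].
  exact: leq_trans (subset_leq_card (slice_sub p TS)) (Sk p).
exact: disjointWl (slice_sub _ TS) (disjointWr (slice_sub _ TS) (Sd b)).
Qed.

Lemma dp_cones0 : set0 \in dp_cones N k.
Proof.
have E p : slice (set0 : {set dp_ray N k}) p = set0.
  by apply/setP => i; rewrite !inE.
apply/dp_conesP; split=> [p|b]; first by rewrite E cards0.
by rewrite E disjoints_subset sub0set.
Qed.

Lemma dp_cones1 (r : dp_ray N k) : [set r]%SET \in dp_cones N k.
Proof.
case: r => [p0 i0].
have E p : slice [set (p0, i0)]%SET p = if p == p0 then [set i0]%SET else set0.
  by apply/setP => i; rewrite !inE xpair_eqE; case: eqP; rewrite !inE.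
apply/dp_conesP; split=> [p|b]; rewrite !E.
  by case: ifP; rewrite ?cards1 ?cards0.
case: p0 {E} => b0 e0; rewrite !xpair_eqE; case: (b == b0) => /=.
  by case: e0 => /=; rewrite disjoints_subset ?sub0set// setC0 subsetT.
by rewrite disjoints_subset ?sub0set.
Qed.

Lemma slice_disjoint S b e : S \in dp_cones N k ->
  [disjoint slice S (b, e) & slice S (b, ~~ e)].
Proof. by move=> /dp_conesP[_ /(_ b)]; case: e; rewrite // disjoint_sym. Qed.

Lemma cone_card_lt S b : S \in dp_cones N k ->
  (#|slice S (b, true)| + #|slice S (b, false)| < #|{: I}|)%N.
Proof.
move=> /dp_conesP[Sk _]; rewrite card_ord ltnS.
by apply: leq_trans (leq_add (Sk _) (Sk _)) _; rewrite addnn.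
Qed.

Definition support_block (D : dp_ray N k -> rat) S b : I -> rat :=
  balanced (slice S (b, true)) (slice S (b, false))
           (fun i => D (b, true, i)) (fun i => D (b, false, i)).

Lemma sum_support_block D S b : S \in dp_cones N k -> \sum_i support_block D S b i = 0.
Proof.
by move=> Sc; apply: sum_balanced; [exact: cone_card_lt | exact: (slice_disjoint b true)].
Qed.

Lemma pairing_support D S b e i : S \in dp_cones N k ->
  pairing (dual_row (support_block D S)) (dp_gen (b, e, i))
  = (sg e)%:~R * support_block D S b i.
Proof. by move=> Sc; rewrite pairing_dual_row//; exact: sum_support_block. Qed.

Lemma pairing_support_in D S r : S \in dp_cones N k -> r \in S ->
  pairing (dual_row (support_block D S)) (dp_gen r) = D r.
Proof.
case: r => [[b e] i] Sc iS; rewrite pairing_support//.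
have iS' : i \in slice S (b, e) by rewrite inE.
have := slice_disjoint b e Sc.
rewrite /support_block /balanced; case: e iS iS' => iS iS' dis.
  by rewrite iS' mul1r.
by rewrite iS' (disjointFr dis iS') mulN1r opprK.
Qed.

(** On the free indices the form is constant, equal to (#|B| - #|A|) divided by
    the number 2k + 1 - #|A| - #|B| of these indices; that its absolute value is
    less than 1 says exactly that 2 #|A| and 2 #|B| are less than 2k + 1. *)
Lemma dp_strictly_supports S : S \in dp_cones N k ->
  exists m, @strictly_supports _ X (fun=> 1) S m.
Proof.
move=> Sc; exists (dual_row (support_block (fun=> 1) S)); split=> [r|[[b e] i]] rS.
  by rewrite pairing_support_in.
rewrite pairing_support// /support_block /balanced.
have [Sk _] := dp_conesP _ Sc.
have := Sk (b, true); have := Sk (b, false).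
have rS' : i \in slice S (b, e) = false by rewrite inE; apply/negbTE.
set A := slice S (b, true) in rS' *; set B := slice S (b, false) in rS' *.
move=> cB cA.
have c_lt1 : `|balance_const A B (fun=> 1) (fun=> 1)| < 1.
  rewrite /balance_const !sumr_const card_ord.
  exact: ratio_lt1.
move: rS' c_lt1; rewrite ltr_norml /A /B => rS' /andP[c1 c2].
case: e rS rS' => rS /= -> ; rewrite ?mul1r ?mulN1r.
  case: ifP => _ //; lra.
case: ifP => _; lra.
Qed.

(** A cone uses at most 2k of the 2k+1 indices of each factor.  Omitting in each
    factor an index mu that is not used, the other v_i form a basis of the
    lattice, whose dual basis consists of the differences of the coordinate
    functions at i and at mu. *)
Lemma dP_smooth : smooth_fan X.
Proof.
move=> S Sc.
have /fin_all_exists[mu muP] : forall b, exists i,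
    (i \notin slice S (b, true)) && (i \notin slice S (b, false)).
  move=> b; apply/existsP; rewrite -[X in is_true X]negbK negb_exists.
  apply/negP => /forallP H.
  have := cone_card_lt b Sc; rewrite ltnNge => /negP; apply.
  rewrite -cardsT.
  have <- : (slice S (b, true) :|: slice S (b, false) = setT)%SET.
    by apply/setP => i; have := H i; rewrite !inE -negb_or negbK.
  by rewrite cardsU leq_subr.
pose si b i := (b, true, i) \in S.
(* default index for the rays outside S, on which co is arbitrary *)
have j0 : 'I_(k.*2) by exists 0%N; rewrite double_gt0.
(* co numbers the rays of S by the basis vectors, ra is its inverse *)
pose co (r : dp_ray N k) : dp_coord N k :=
  (r.1.1, odflt j0 (unlift (mu r.1.1) r.2)).
pose ra (c : dp_coord N k) : dp_ray N k :=
  (c.1, si c.1 (lift (mu c.1) c.2), lift (mu c.1) c.2).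
have raco r : r \in S -> ra (co r) = r.
  case: r => [[b e] i] rS; rewrite /ra /co/=.
  have iS : i \in slice S (b, e) by rewrite inE.
  have imu : mu b != i.
    by apply: contraTneq iS => <-; have := muP b; case: (e) => /andP[].
  have [j ij ->] := unlift_some imu; rewrite /= -ij; congr (_, _, _).
  rewrite /si; case: e rS iS {imu} => // rS iS.
  by have := disjointFl (slice_disjoint b true Sc) iS; rewrite inE.
pose B := \matrix_(q < dp_dim N k) dp_gen (ra (enum_val q)).
pose g (c : dp_coord N k) b i : int := if b == c.1 then
  sg (si c.1 (lift (mu c.1) c.2)) *
  ((i == lift (mu c.1) c.2)%:R - (i == mu c.1)%:R) else 0.
have g0 c b : \sum_i g c b i = 0.
  rewrite /g; case: eqP => _; last by rewrite big1.
  rewrite -mulr_sumr sumrB.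
  by rewrite !sum_pred1 subrr mulr0.
pose C := (\matrix_(q < dp_dim N k) dual_row (g (enum_val q)))^T.
have BC : B *m C = 1%:M.
  apply/matrixP => q q'.
  have -> : (B *m C) q q'
      = pairing (dual_row (g (enum_val q'))) (dp_gen (ra (enum_val q))).
    rewrite mxE /pairing; apply: eq_bigr => l _.
    by rewrite !mxE intz mulrC.
  rewrite pairing_dual_row ?g0// mxE /g -(inj_eq enum_val_inj).
  case: (enum_val q) => b j; case: (enum_val q') => b' j' /=.
  rewrite xpair_eqE; case: eqP => [<-|_]; last by rewrite mulr0.
  rewrite (inj_eq lift_inj) [lift _ _ == mu b]eq_sym (negbTE (neq_lift _ _)) subr0.
  case: eqP => [->|_]; last by rewrite !mulr0.
  by rewrite /sg; case: ifP; rewrite ?mulr1 ?intz// mulrNN mulr1.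
exists B; split; first by have [] := mulmx1_unit BC.
exists (fun r => enum_rank (co r)) => [r r' rS r'S /enum_rank_inj e|r rS].
  by rewrite -(raco r)// e raco.
by rewrite rowK enum_rankK raco.
Qed.

(** In each factor, a point is a combination of the v_i with coefficients y_i
    determined up to a common constant.  Subtracting a median t leaves at most
    k positive and at most k negative coefficients. *)
Lemma dP_complete : complete_fan X.
Proof.
move=> x.
pose y b i := if unlift ord0 i is Some j then x 0 (enum_rank (b, j)) else 0.
have /fin_all_exists[t tP] b := median_exists (y b).
pose S : {set dp_ray N k} := [set r | if r.1.2 then t r.1.1 < y r.1.1 r.2
                                      else y r.1.1 r.2 < t r.1.1].
have St b : slice S (b, true) = [set i | t b < y b i].
  by apply/setP => i; rewrite !inE.
have Sf b : slice S (b, false) = [set i | y b i < t b].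
  by apply/setP => i; rewrite !inE.
exists S.
  apply/dp_conesP; split=> [[b e]|b]; have [ta tb] := tP b.
    by case: e; rewrite ?St ?Sf.
  rewrite St Sf disjoints_subset; apply/subsetP => i; rewrite !inE => ti.
  by rewrite -leNgt ltW.
exists (fun r => `|y r.1.1 r.2 - t r.1.1|); split=> //.
apply/rowP => l; rewrite summxE.
rewrite big_mkcond sum_rays/=.
case El : (enum_val l) => [b j].
have lE : l = enum_rank (b, j) by rewrite -El enum_valK.
rewrite (bigD1 b)//= [X in _ = _ + X]big1 ?addr0 => [|b' b'b]; last first.
  rewrite big1// => e _; rewrite big1// => i _; case: ifP => // _.
  by rewrite !mxE El/= (negbTE b'b) mulr0.
rewrite exchange_big/=.
(* the rays of S carry exactly the nonzero coefficients y i - t *)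
transitivity (\sum_i (y b i - t b) * (block_gen i j)%:~R).
  rewrite (eq_bigr (fun i => (y b i - t b) * (i == lift ord0 j)%:R
      - (y b i - t b) * (i == ord0)%:R)); last first.
    by move=> i _; rewrite rmorphB/= !rmorph_nat mulrBr.
  rewrite sumrB.
  by rewrite !sum_mul_pred1 /y liftK unlift_none lE; lra.
apply: eq_bigr => i _; rewrite big_bool/= !inE/= !mxE El/= eqxx /sg mul1r mulN1r rmorphN/=.
case: ltgtP => h; rewrite ?add0r ?addr0.
- by rewrite gtr0_norm ?subr_gt0.
- by rewrite ltr0_norm ?subr_lt0// mulrNN.
- by rewrite h subrr mul0r.
Qed.

Lemma dP_is_fan : is_fan X.
Proof.
apply: smooth_is_fan; [exact: dP_smooth|exact: dp_cones1| |exact: dp_cones0|].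
  by move=> S T; exact: dp_cones_sub.
exact: dp_strictly_supports.
Qed.

Lemma dP_ample : ample (anticanonical X).
Proof.
apply: strictly_supports_ample => S; rewrite inE => /andP[Sc _].
have [m [m1 m2]] := dp_strictly_supports Sc.
by exists m; split=> r rS; rewrite ffunE; [exact: m1|exact: m2].
Qed.

Lemma dP_Fano : smooth_toric_Fano X.
Proof. by split; [exact: dP_is_fan|exact: dP_smooth|exact: dP_complete|exact: dP_ample]. Qed.

(** The dimension 2kN is reached only if all of the 2N bounds by k on the
    slices are equalities. *)
Lemma dp_max_conesP S :
  reflect (S \in dp_cones N k /\ forall p, #|slice S p| = k) (S \in max_cones X).
Proof.
rewrite (smooth_max_conesP dP_smooth) -[S \in cones X]/(S \in dp_cones N k).
have dE : (dp_dim N k = \sum_(p : 'I_N * bool) k)%N.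
  rewrite sum_nat_const card_prod card_ord card_bool dp_dimE; lia.
apply: (iffP andP) => -[Sc].
  have [Sk _] := dp_conesP _ Sc.
  rewrite dp_card_slices dE.
  have := @leqif_sum _ xpredT (fun p => #|slice S p| == k) (fun p => #|slice S p|) (fun=> k)
     (fun p _ => leqif_eq (Sk p)).
  by move=> /leqifP; case: forallP => [h _ _|_ /ltn_eqF ->//]; split=> // p; apply/eqP/h.
by move=> Sk; rewrite dp_card_slices dE (eq_bigr _ (fun p _ => Sk p)).
Qed.

End DelPezzoFano.

(** * The nef cone *)

Section DelPezzoNef.
Variables (N k : nat).
Hypothesis k_gt0 : (0 < k)%N.
Local Notation I := 'I_(k.*2.+1).
Local Notation X := (dP N k).
Implicit Types (S T : {set dp_ray N k}) (b : 'I_N) (e : bool) (i : I) (B : {set I}).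

Lemma card_setC_half B : #|B| = k -> #|~: B| = k.+1.
Proof. by move=> cB; have := cardsC B; rewrite card_ord cB; lia. Qed.

Lemma setC_half (A B : {set I}) i : [disjoint A & B] -> #|A| = k -> #|B| = k ->
  i \notin A -> i \notin B -> ~: B = i |: A.
Proof.
move=> dAB cA cB iA iB; apply/esym/eqP; rewrite eqEcard subUset sub1set inE iB.
by rewrite -disjoints_subset dAB card_setC_half// cardsU1 iA cA add1n leqnn.
Qed.

(** D has nonnegative degree on the primitive relations that express the sum of
    k+1 rays of one sign as the sum of the k opposite rays on the other
    indices. *)
Definition primitive_nef (D : dp_ray N k -> int) : Prop :=
  forall b e B, #|B| = k ->
    \sum_(i in B) D (b, ~~ e, i) <= \sum_(i in ~: B) D (b, e, i).

(** With i, A, B a partition of the indices, the relation v_i + (-v_i) = 0 is the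
    sum of the primitive relations of (i + A, B) and (i + B, A). *)
Lemma primitive_nef_ge0 D b e i : primitive_nef D -> 0 <= D (b, e, i) + D (b, ~~ e, i).
Proof.
move=> Dn.
have [] := @subset_card_between _ set0 [set~ i] k (sub0set _).
  by rewrite cards0 cardsC1 card_ord; lia.
move=> B [_ /subsetP Bi cB].
have iB : i \notin B by apply/negP => /Bi; rewrite !inE eqxx.
have cA : #|~: (i |: B)| = k.
  by have := cardsC (i |: B); rewrite cardsU1 iB cB card_ord; lia.
have := Dn b e B cB; have := Dn b (~~ e) _ cA; rewrite setCK negbK big_setU1//=.
rewrite (_ : ~: B = i |: ~: (i |: B)); last first.
  by apply/setP => l; rewrite !inE; case: eqP => // ->; rewrite iB.
rewrite big_setU1/=; first by lra.
by rewrite !inE eqxx.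
Qed.

(** A facet leaves one index free in each factor.  The support function of D
    interpolates D on the facet; its value at the free index is bounded by the
    two primitive relations involving that index, and its values at the
    opposites of the rays of the facet by [primitive_nef_ge0]. *)
Lemma primitive_nef_nef (D : divisor X) : primitive_nef D -> nef D.
Proof.
move=> Dn; apply: supports_nef => S /(dp_max_conesP k_gt0)[Sc Sk].
exists (dual_row (support_block (fun r => (D r)%:~R) S)).
split=> [r|[[b e] i]] rS; first by rewrite pairing_support_in.
rewrite pairing_support// /support_block /balanced.
have rS' : i \notin slice S (b, e) by rewrite inE.
have := Sk (b, true); have := Sk (b, false); have := slice_disjoint b true Sc.
have := primitive_nef_ge0 b e i Dn; rewrite -(ler0z rat) rmorphD/=.
rewrite /balance_const.
set A := slice S (b, true) in rS' *; set B := slice S (b, false) in rS' *.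
move=> c0 dAB cB cA; rewrite cA cB card_ord addnn subSnn divr1.
case: e rS rS' c0 => /= rS rS' c0.
  rewrite mul1r -/A (negbTE rS'); case: ifPn => iB; first by lra.
  have := Dn b true B cB; rewrite (setC_half dAB cA cB rS' iB) big_setU1//=.
  by rewrite -(ler_int rat) rmorphD/= !rmorph_sum/=; lra.
rewrite mulN1r -/B (negbTE rS'); case: ifPn => iA; first by lra.
have := Dn b false A cA; rewrite disjoint_sym in dAB.
rewrite (setC_half dAB cB cA rS' iA) big_setU1//=.
by rewrite -(ler_int rat) rmorphD/= !rmorph_sum/=; lra.
Qed.

(** The index mu b is the one that the facet leaves free in the factor b; using
    the same B in all factors is enough to realize every primitive relation. *)
Definition facet B e (mu : 'I_N -> I) : {set dp_ray N k} :=
  [set r | if r.1.2 == e then (r.2 \notin B) && (r.2 != mu r.1.1) else r.2 \in B].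

Lemma facet_max B e mu : #|B| = k -> (forall b, mu b \notin B) ->
  facet B e mu \in max_cones X.
Proof.
move=> cB muB.
have s1 b : slice (facet B e mu) (b, e) = ~: B :\ mu b.
  by apply/setP => i; rewrite !inE/= eqxx andbC.
have s2 b : slice (facet B e mu) (b, ~~ e) = B.
  by apply/setP => i; rewrite !inE/=; case: (e).
have c1 b : #|slice (facet B e mu) (b, e)| = k.
  by apply: succn_inj; rewrite s1 -(card_setC_half cB) [RHS](cardsD1 (mu b)) inE muB.
have c2 b : #|slice (facet B e mu) (b, ~~ e)| = k by rewrite s2.
have c p : #|slice (facet B e mu) p| = k.
  case: p => b e'; have [->//|e'e] := eqVneq e' e.
  by have -> : e' = ~~ e by case: (e) (e') e'e => -[].
have dis b : [disjoint ~: B :\ mu b & B].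
  by rewrite disjoints_subset subDset subsetUr.
apply/dp_max_conesP => //; split=> //; apply/dp_conesP; split=> [p|b].
  by rewrite c.
have : [disjoint slice (facet B e mu) (b, e) & slice (facet B e mu) (b, ~~ e)].
  by rewrite s1 s2.
by case: (e); rewrite // disjoint_sym.
Qed.

(** The walls that see the primitive relation of B and e in the factor b: the two
    facets omit the indices j and i there, and coincide in the other
    factors. *)
Section Wall.
Variables (b : 'I_N) (e : bool) (B : {set I}) (i j : I).
Hypotheses (cB : #|B| = k) (iB : i \notin B) (jB : j \notin B) (ij : i != j).

Definition wall : {set dp_ray N k} := facet B e (fun=> j) :\ (b, e, i).

Definition wall_coef (r : dp_ray N k) : int :=
  if r.1.1 == b then if r.1.2 == e then 1 else -1 else 0.

Lemma wallU1i : (b, e, i) |: wall = facet B e (fun=> j).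
Proof. by rewrite setD1K// inE/= eqxx iB ij. Qed.

Lemma wallU1j : (b, e, j) |: wall = facet B e (fun b' => if b' == b then i else j).
Proof.
apply/setP => -[[b' e'] i']; rewrite !inE/= !xpair_eqE.
case: (b' == b); case: (e' == e) => //=.
have [->|_] := eqVneq i' j; first by rewrite jB eq_sym ij.
by case: (i' == i); case: (i' \in B).
Qed.

Lemma wall_is_wall : @is_wall _ X wall (b, e, i) (b, e, j).
Proof.
split; rewrite ?wallU1i ?wallU1j.
- by rewrite !inE eqxx.
- by rewrite !inE/= eqxx eqxx andbF andbF.
- by rewrite xpair_eqE eqxx.
- by apply: facet_max.
- by apply: facet_max => // b'; case: ifP.
Qed.

(** Stated for any additive group, so as to give both the wall relation, with G
    the ray generators, and the degree of a divisor on the curve. *)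
Lemma wall_sum (V : zmodType) (G : dp_ray N k -> V) :
  G (b, e, i) + G (b, e, j) + \sum_(r in wall) G r *~ wall_coef r
  = \sum_(l in ~: B) G (b, e, l) - \sum_(l in B) G (b, ~~ e, l).
Proof.
have c1 l : wall_coef (b, e, l) = 1 by rewrite /wall_coef !eqxx.
have := wall_is_wall => -[iw jw ijr _ _].
transitivity (\sum_(r in (b, e, j) |: ((b, e, i) |: wall)) G r *~ wall_coef r).
  rewrite big_setU1/=; last first.
    by move: jw; rewrite !inE negb_or xpair_eqE/= eqxx/= (eq_sym j) ij.
  by rewrite big_setU1//= !c1 addrA [X in X + _]addrC.
rewrite wallU1i big_mkcond sum_rays (bigD1 b)//= [X in _ + X]big1 ?addr0.
  transitivity (\sum_(e' : bool) if e' == e then \sum_(l in ~: B) G (b, e, l)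
     else - \sum_(l in B) G (b, ~~ e, l)).
    apply: eq_bigr => e' _; have [->|e'e] := eqVneq e' e.
      rewrite [RHS]big_mkcond; apply: eq_bigr => l _.
      rewrite !inE/= xpair_eqE !eqxx c1/=.
      by have [->|_] := eqVneq l j; rewrite /= ?jB ?andbT.
    have -> : e' = ~~ e by case: (e) (e') e'e => -[].
    rewrite -sumrN [RHS]big_mkcond; apply: eq_bigr => l _.
    rewrite !inE/= !xpair_eqE /wall_coef/= eqxx.
    by have -> : (~~ e == e) = false; [case: e|rewrite andbF mulrN1z].
  by rewrite big_bool; case: e => //=; rewrite addrC.
move=> b' b'b; rewrite big1// => e' _; rewrite big1// => l _.
by rewrite /wall_coef/= (negbTE b'b) mulr0z; case: ifP.
Qed.

End Wall.

Lemma nef_primitive_nef (D : divisor X) : nef D -> primitive_nef D.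
Proof.
move=> Dn b e B cB.
have /card_gt1P[i [j [iB jB ij]]] : (1 < #|~: B|)%N by rewrite card_setC_half.
move: iB jB; rewrite !inE => iB jB.
have rel : @wall_relation _ X (wall b e B i j) (b, e, i) (b, e, j) (wall_coef b e).
  rewrite /wall_relation (wall_sum b e cB iB jB ij (fun r => dp_gen r)).
  under [X in _ - X]eq_bigr do rewrite dp_gen_neg.
  rewrite sumrN opprK addrC.
  have := sum_dp_gen k b e; rewrite (bigID (fun i => i \in B))/= => h.
  by rewrite -[RHS]h; congr (_ + _); apply: eq_bigl => l; rewrite inE.
have := Dn _ _ _ _ (wall_is_wall b e cB iB jB ij) rel.
rewrite /curve_degree (eq_bigr (fun r => D r *~ wall_coef b e r)).
  by rewrite (wall_sum b e cB iB jB ij D) subr_ge0.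
by move=> r _; rewrite mulrzz.
Qed.

End DelPezzoNef.

(** * Degrees and decompositions of the anticanonical class *)

Section DelPezzoDegree.
Variables (N k : nat).
Hypothesis k_gt0 : (0 < k)%N.
Local Notation I := 'I_(k.*2.+1).
Local Notation X := (dP N k).
Implicit Types (b : 'I_N) (e : bool) (i : I) (B : {set I}).

(** The degree on the b-th factor, invariant under linear equivalence because
    the rays of each factor and sign add up to 0. *)
Definition block_deg (K : nmodType) (D : dp_ray N k -> K) b : K :=
  \sum_e \sum_i D (b, e, i).

Lemma lin_equiv_block_deg (K : numDomainType) (D E : dp_ray N k -> K) b :
  lin_equiv (X := X) D E -> block_deg D b = block_deg E b.
Proof.
move=> [m DE]; apply/eqP; rewrite -subr_eq0 -sumrB big1// => e _.
rewrite -sumrB -[RHS](sum_pairing_dp_gen m b e).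
by apply: eq_bigr => i _; exact: DE.
Qed.

Lemma half_set_exists : exists L : {set I}, #|L| = k.
Proof.
have [] := @subset_card_between _ set0 [set: I] k (sub0set _).
  by rewrite cards0 cardsT card_ord; lia.
by move=> L [_ _ cL]; exists L.
Qed.

Definition pair_deg (D : dp_ray N k -> int) b i : int :=
  D (b, true, i) + D (b, false, i).

Lemma block_degE (D : dp_ray N k -> int) b :
  block_deg D b = \sum_i pair_deg D b i.
Proof. by rewrite /block_deg big_bool big_split. Qed.

Lemma primitive_nef_sum_half (D : dp_ray N k -> int) b B : primitive_nef D -> #|B| = k ->
  \sum_(i in B) pair_deg D b i <= \sum_(i in ~: B) pair_deg D b i.
Proof.
by move=> Dn cB; have := Dn b true B cB; have := Dn b false B cB; rewrite !big_split/=; lra.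
Qed.

Lemma sum_setC (V : nmodType) (F : I -> V) B :
  \sum_i F i = \sum_(i in B) F i + \sum_(i in ~: B) F i.
Proof.
rewrite (bigID (fun i => i \in B))/=; congr (_ + _).
by apply: eq_bigl => i; rewrite inE.
Qed.

(** Let P be the support of the c_i, whose total is the degree W.  If P has at
    most k elements, choose B containing P: the inequality reads W <= 0.
    Otherwise choose B inside P: W is at least twice the sum over B, where all
    the c_i are at least 1. *)
Lemma primitive_nef_deg_ge (D : dp_ray N k -> int) b : primitive_nef D ->
  block_deg D b != 0 -> k.*2%:R <= block_deg D b.
Proof.
move=> Dn; rewrite block_degE.
set c := pair_deg D b.
have c0 i : 0 <= c i := primitive_nef_ge0 k_gt0 b true i Dn.
pose P := [set i | c i != 0].
have [Pk|kP] := leqP #|P| k => W0.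
  have [|B [/subsetP PB _ cB]] := @subset_card_between _ P [set: I] k (subsetT _).
    by rewrite Pk cardsT card_ord; lia.
  have B0 : \sum_(i in ~: B) c i = 0.
    rewrite big1// => i; rewrite inE => iB; apply/eqP; apply: contraNT iB => ci.
    by apply: PB; rewrite inE.
  have := primitive_nef_sum_half b Dn cB; rewrite -/c B0 => le0.
  by case/negP: W0; rewrite (sum_setC c B) B0 addr0 eq_le le0 sumr_ge0.
have [|B [_ /subsetP BP cB]] := @subset_card_between _ set0 P k (sub0set _).
  by rewrite cards0 (ltnW kP).
have : #|B|%:R <= \sum_(i in B) c i.
  rewrite -sumr_const; apply: ler_sum => i /BP; rewrite inE; have := c0 i; lia.
have := primitive_nef_sum_half b Dn cB; rewrite -/c.
rewrite cB (sum_setC c B) (_ : k.*2%:R = k%:R + k%:R); first by lra.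
by rewrite -natrD addnn.
Qed.

(** Degree 0 forces all the c_i to vanish; the two nefness inequalities of a set
    B then bound the sum of the D(v_i) from both sides by 0. *)
Lemma primitive_nef_deg0 (D : dp_ray N k -> int) b : primitive_nef D ->
  block_deg D b = 0 ->
  (forall i, D (b, false, i) = - D (b, true, i)) /\ \sum_i D (b, true, i) = 0.
Proof.
move=> Dn W0.
have E i : D (b, false, i) = - D (b, true, i).
  apply/eqP; rewrite -addr_eq0 addrC.
  have c0 l : true -> 0 <= pair_deg D b l.
    by move=> _; exact: (primitive_nef_ge0 k_gt0 b true l Dn).
  move: W0; rewrite block_degE => /eqP; rewrite psumr_eq0//.
  by move=> /allP/(_ i (mem_index_enum _)).
split=> //; have [B cB] := half_set_exists.
have := Dn b true B cB; have := Dn b false B cB; rewrite /= (sum_setC _ B).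
rewrite (eq_bigr _ (fun i _ => E i)) [in X in _ -> X -> _](eq_bigr _ (fun i _ => E i)).
by rewrite !sumrN; lra.
Qed.

Lemma nef_nontrivial_deg (D : divisor X) : nef D -> ~ lin_equiv D (fun=> 0) ->
  exists b, block_deg D b != 0.
Proof.
move=> /(nef_primitive_nef k_gt0) Dn D0; apply/existsP.
apply: contra_notT D0; rewrite negb_exists => /forallP W0.
have Z b := primitive_nef_deg0 Dn (eqP (negbNE (W0 b))).
exists (dual_row (fun b i => D (b, true, i))) => -[[b e] i].
have [E s0] := Z b; rewrite pairing_dual_row// subr0 intz.
by case: e; rewrite ?mul1r// E mulN1r.
Qed.

Lemma block_deg_nontrivial (D : divisor X) b : block_deg D b != 0 -> ~ lin_equiv D (fun=> 0).
Proof.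
move=> W0 /lin_equiv_block_deg-/(_ b) e; move: W0; rewrite e /block_deg.
by rewrite big1 ?eqxx// => e' _; rewrite big1.
Qed.

(** u b collects the weights of the terms that are nontrivial on the factor b.
    Each term is nontrivial on some factor, and each of those counted in u b
    contributes at least 2k to the degree 4k+2 of -K on that factor. *)
Lemma weights_le (K : numDomainType) (w : K) :
  decomposition_weights (anticanonical X) w ->
  exists2 u : 'I_N -> K, w <= \sum_b u b & forall b, u b * k.*2%:R <= (k.*2.+1).*2%:R.
Proof.
move=> [n [a [E [a0 En DE ->]]]].
have Wge l b : block_deg (E l) b != 0 -> k.*2%:R <= block_deg (E l) b.
  by apply: primitive_nef_deg_ge; apply: nef_primitive_nef => //; case: (En l).
exists (fun b => \sum_(l < n | block_deg (E l) b != 0) a l).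
  under [leRHS]eq_bigr => b _ do rewrite big_mkcond.
  rewrite [leRHS]exchange_big/=; apply: ler_sum => l _.
  have [En1 /(nef_nontrivial_deg En1)[b Wb]] := En l.
  rewrite (bigD1 b)//= Wb lerDl; apply: sumr_ge0 => b' _.
  by case: ifP => // _; exact: ltW.
move=> b.
have := lin_equiv_block_deg b DE.
have -> : block_deg (fun r : dp_ray N k => (anticanonical X r)%:~R : K) b = (k.*2.+1).*2%:R.
  rewrite /block_deg big_bool/=.
  under eq_bigr => i _ do rewrite ffunE.
  rewrite [X in _ + X](eq_bigr (fun=> 1)); last by move=> i _; rewrite ffunE.
  by rewrite sumr_const card_ord -natrD addnn.
move=> ->.
have -> : block_deg (fun r => \sum_(l < n) a l * (E l r)%:~R) b
    = \sum_(l < n) a l * (block_deg (E l) b)%:~R.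
  rewrite /block_deg; under eq_bigr => e _ do rewrite exchange_big/=.
  rewrite exchange_big/=; apply: eq_bigr => l _; rewrite rmorph_sum mulr_sumr.
  by apply: eq_bigr => e _; rewrite rmorph_sum mulr_sumr.
rewrite mulr_suml [leRHS](bigID (fun l => block_deg (E l) b != 0))/=.
rewrite [X in _ <= _ + X]big1 ?addr0 => [|l]; last by rewrite negbK => /eqP->; rewrite mulr0.
apply: ler_sum => l Wl; rewrite ler_pM2l//.
by have := Wge _ _ Wl; rewrite -(ler_int K) rmorph_nat.
Qed.

Lemma weights_of_family (K : numDomainType) (T : finType) (a : K) (D : divisor X)
    (E : T -> divisor X) :
  0 < a -> (forall t, nef (E t) /\ ~ lin_equiv (E t) (fun=> 0)) ->
  (forall r, (D r)%:~R = a * \sum_t (E t r)%:~R) ->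
  decomposition_weights D (a * #|T|%:R).
Proof.
move=> a0 En DE; exists #|T|, (fun=> a), (fun l => E (enum_val l)); split=> //.
  exists 0 => r; rewrite pairing0l DE -mulr_sumr; apply/eqP.
  rewrite subr_eq0; apply/eqP; congr (_ * _).
  by rewrite (big_enum_val (A := T) (fun t => (E t r)%:~R)).
by rewrite sumr_const card_ord mulr_natr.
Qed.

(** A nef class of minimal degree 2k, with c_i = 1 for i <> p and c_p = 0.  Among its
    linearly equivalent representatives, this one makes the sum over p equal to
    k times -K on the nose. *)
Definition corner_divisor (c : 'I_N * I) : divisor X := [ffun r : dp_ray N k =>
  if r.1.1 == c.1 then
    if r.1.2 then 1 - (r.2 == c.2)%:R * k.+1%:R else (r.2 == c.2)%:R * k%:R
  else 0].

Lemma corner_divisor_nef c : nef (corner_divisor c).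
Proof.
case: c => b0 p; apply: primitive_nef_nef => // b e B cB.
have [<-|bb0] := eqVneq b b0; last first.
  by rewrite !big1// => i _; rewrite ffunE/= (negbTE bb0).
under eq_bigr => i _ do rewrite ffunE/= eqxx.
under [leRHS]eq_bigr => i _ do rewrite ffunE/= eqxx.
case: e => /=.
  rewrite sumrB -!mulr_suml !sum_indicator sumr_const card_setC_half// inE.
  by case: (p \in B); rewrite /= ?mul1r ?mul0r; lia.
rewrite sumrB -!mulr_suml !sum_indicator sumr_const cB inE.
by case: (p \in B); rewrite /= ?mul1r ?mul0r; lia.
Qed.

Lemma corner_divisor_deg b p : block_deg (corner_divisor (b, p)) b = k.*2%:R.
Proof.
rewrite block_degE.
under eq_bigr => i _ do rewrite /pair_deg !ffunE/= eqxx.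
rewrite big_split sumrB/= -!mulr_suml sum_pred1.
rewrite sumr_const card_ord; lia.
Qed.

Lemma tauQ_weight : decomposition_weights (anticanonical X)
  ((k%:R)^-1 * #|{: 'I_N * I}|%:R : rat).
Proof.
apply: (weights_of_family (E := corner_divisor)).
- by rewrite invr_gt0 ltr0n.
- case=> b p; split; first exact: corner_divisor_nef.
  apply: (@block_deg_nontrivial _ b); rewrite corner_divisor_deg.
  by rewrite pnatr_eq0 double_eq0 -lt0n.
- case=> [[b e] i]; rewrite ffunE -rmorph_sum.
  have -> : \sum_t corner_divisor t (b, e, i) = k%:R.
    rewrite -(pair_bigA _ (fun b' p => corner_divisor (b', p) (b, e, i)))/=.
    rewrite (bigD1 b)//= [X in _ + X]big1 ?addr0 => [|b' b'b]; last first.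
      by rewrite big1// => p _; rewrite ffunE/= eq_sym (negbTE b'b).
    under eq_bigr => p _ do rewrite ffunE/= eqxx eq_sym.
    case: e; last by rewrite -mulr_suml sum_pred1 mul1r.
    rewrite sumrB -mulr_suml sum_pred1 mul1r sumr_const card_ord; lia.
  by rewrite rmorph_nat mulVf// pnatr_eq0 -lt0n.
Qed.

(** * Decompositions with integral weights *)

Section Halves.
Variable L : {set I}.
Hypothesis cL : #|L| = k.

(** For each factor, the two divisors cut -K there into two complementary halves:
    each contains exactly one of v_i and -v_i for every i, with k or k+1
    positive rays. *)
Definition half_divisor (c : 'I_N * bool) : divisor X := [ffun r : dp_ray N k =>
  if r.1.1 == c.1 then ((r.2 \in L) == (r.1.2 == c.2))%:R else 0].

Lemma half_divisor_flip c e i :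
  half_divisor c (c.1, ~~ e, i) = 1 - half_divisor c (c.1, e, i).
Proof.
rewrite !ffunE/= eqxx; case: c => b e0 /=.
by case: (i \in L); case: e; case: e0.
Qed.

(** Since c_i = 1 for every i, the inequality for B and e says that at least k
    rays of sign e occur in the divisor. *)
Lemma half_divisor_nef c : nef (half_divisor c).
Proof.
apply: primitive_nef_nef => // b e B cB.
have [->|bb0] := eqVneq b c.1; last first.
  by rewrite !big1// => i _; rewrite ffunE/= (negbTE bb0).
rewrite (eq_bigr _ (fun i _ => half_divisor_flip c e i)) sumrB sumr_const cB.
rewrite lerBlDr addrC -sum_setC.
under eq_bigr => i _ do rewrite ffunE/= eqxx.
case: (e == c.2).
  under eq_bigr => i _ do rewrite eqb_id.
  rewrite (sum_setC _ L) (eq_bigr (fun=> 1)) => [|i ->//].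
  by rewrite sumr_const cL lerDl sumr_ge0.
under eq_bigr => i _ do rewrite eqbF_neg.
rewrite (sum_setC _ L) [X in _ + X](eq_bigr (fun=> 1)) => [|i]; last by rewrite inE => ->.
rewrite sumr_const card_setC_half// -[leLHS]add0r lerD ?sumr_ge0// ler_nat.
by rewrite leqnSn.
Qed.

Lemma half_divisor_deg c : block_deg (half_divisor c) c.1 = k.*2.+1%:R.
Proof.
rewrite block_degE (eq_bigr (fun=> 1)) ?sumr_const ?card_ord// => i _.
by rewrite /pair_deg -[false]/(~~ true) half_divisor_flip addrC subrK.
Qed.

Lemma tauZ_weight :
  decomposition_weights (anticanonical X) (1 * #|{: 'I_N * bool}|%:R : int).
Proof.
apply: (weights_of_family (E := half_divisor)) => // [c|[[b e] i]].
  split; first exact: half_divisor_nef.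
  apply: (@block_deg_nontrivial _ c.1); rewrite half_divisor_deg.
  by rewrite pnatr_eq0.
rewrite ffunE mul1r -rmorph_sum; congr (_%:~R).
rewrite -(pair_bigA _ (fun b' e' => half_divisor (b', e') (b, e, i)))/=.
rewrite (bigD1 b)//= [X in _ + X]big1 ?addr0 => [|b' b'b]; last first.
  by rewrite big1// => p _; rewrite ffunE/= eq_sym (negbTE b'b).
rewrite big_bool/= !ffunE/= eqxx.
by case: (i \in L); case: e.
Qed.

End Halves.

(** * Pseudo-symmetry *)

Definition flip (r : dp_ray N k) : dp_ray N k := (r.1.1, ~~ r.1.2, r.2).

Lemma flipK : involutive flip.
Proof. by case=> [[b e] i]; rewrite /flip/= negbK. Qed.

Lemma cone_flip (S T : {set ray X}) (x : 'rV[rat]_(dp_dim N k)) :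
  (forall r, (r \in T) = (flip r \in S)) -> cone T x -> cone S (- x).
Proof.
move=> ST [c [c0 ->]]; exists (c \o flip); split=> [i|]; first exact: c0.
rewrite -sumrN [RHS](reindex_inj (inv_inj flipK)); apply: eq_big => [r|r _].
  by rewrite ST.
rewrite /= flipK -scalerN; congr (_ *: _).
case: r => [[b e] i]; rewrite /genQ /= /flip/= dp_gen_neg.
by apply/rowP => l; rewrite !mxE rmorphN.
Qed.

Lemma dP_pseudo_symmetric : pseudo_symmetric X.
Proof.
have [L cL] := half_set_exists.
have /card_gt0P[p pL] : (0 < #|~: L|)%N by rewrite card_setC_half.
rewrite inE in pL.
exists (facet L true (fun=> p)), (facet L false (fun=> p)).
split; [exact: facet_max|exact: facet_max|].
have F : forall r, (r \in facet L false (fun=> p)) = (flip r \in facet L true (fun=> p) :> bool).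
  by case=> [[b e] i]; rewrite !inE/=; case: e.
apply/seteqP; split=> [x xT|_ [x xS <-]].
  by exists (- x); [exact: cone_flip F xT | rewrite opprK].
apply: cone_flip xS => r; rewrite F.
by rewrite flipK.
Qed.

(** * The two Gongyo indices *)

Section Tau.
Variable R : realType.

Lemma ereal_sup_max (A : set (\bar R)) (x : \bar R) :
  A x -> ubound A x -> ereal_sup A = x.
Proof.
move=> Ax xA; apply/eqP; rewrite eq_le ge_ereal_sup//=.
exact: ereal_sup_ubound.
Qed.

Lemma dP_tauQ : tauQ R (anticanonical X) = (ratr (N%:R * (2 + k%:R^-1)))%:E.
Proof.
have k0 : (k%:R : rat) != 0 by rewrite pnatr_eq0 -lt0n.
apply: ereal_sup_max.
  exists ((k%:R)^-1 * #|{: 'I_N * I}|%:R); first exact: tauQ_weight.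
  congr (_%:E); congr (ratr _); rewrite card_prod !card_ord -addnn -addn1 natrM !natrD.
  by field.
move=> _ [w /weights_le[u wu ub] <-]; rewrite lee_fin ler_rat.
apply: le_trans wu _.
rewrite -[N in leRHS]card_ord mulr_natl -sumr_const; apply: ler_sum => b _.
have := ub b; rewrite -ler_pdivlMr ?ltr0n ?double_gt0// => /le_trans; apply.
by rewrite -!muln2 !natrM -addn1 natrD natrM le_eqVlt; apply/orP; left; apply/eqP; field.
Qed.

Lemma dP_tauZ : (1 < k)%N -> tauZ R (anticanonical X) = (N.*2%:R)%:E.
Proof.
move=> k1; apply: ereal_sup_max.
  have [L cL] := half_set_exists.
  exists (1 * #|{: 'I_N * bool}|%:R); first exact: tauZ_weight cL.
  by rewrite mul1r card_prod card_ord card_bool muln2 rmorph_nat.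
move=> _ [w /weights_le[u wu ub] <-]; rewrite lee_fin -[leRHS](rmorph_nat intr) ler_int.
apply: le_trans wu _.
rewrite -muln2 mulnC -[N in leRHS]card_ord natrM mulr_natr -sumr_const.
apply: ler_sum => b _; have := ub b; rewrite -!muln2 !natrM => h.
(* a weight of 3 would need degree 6k, more than 4k + 2 *)
rewrite leNgt; apply/negP => u3; nia.
Qed.

Lemma dP_gap : (1 < k)%N -> Gongyo_gap X R = (ratr (N%:R / k%:R))%:E.
Proof.
move=> k1; rewrite /Gongyo_gap dP_tauQ dP_tauZ// -EFinB; congr (_%:E).
rewrite -(ratr_nat R) -rmorphB/=; congr (ratr _).
by rewrite -muln2 natrM; ring.
Qed.

End Tau.
End DelPezzoDegree.

Theorem corollary6p4 (R : realType) (r : rat) (hr : 0 < r) :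
  exists (d : nat) (X : fan d),
    [/\ smooth_toric_Fano X, pseudo_symmetric X
      & Gongyo_gap X R = (ratr r)%:E].
Proof.
have n0 : 0 < numq r by rewrite numq_gt0.
have d0 : (0 < `|denq r|)%N by rewrite absz_gt0 denq_neq0.
(* doubling both terms of the fraction makes k at least 2 *)
exists (dp_dim `|numq r|.*2 `|denq r|.*2), (dP `|numq r|.*2 `|denq r|.*2).
split.
- by apply: dP_Fano; rewrite double_gt0.
- by apply: dP_pseudo_symmetric; rewrite double_gt0.
rewrite dP_gap ?double_gt0//; last by rewrite -addnn; lia.
congr (ratr _)%:E.
rewrite -!muln2 !natrM -mulf_div divff// mulr1 -[RHS]divq_num_den.
by rewrite !natr_absz !ger0_norm// ltW.
Qed.
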